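(* For every integer $m\ge1$, $\deg_{\pm}(\mathrm{MP}^*_m|_{\le m^2\log m})=\Omega(m)$.
   Context: $\mathrm{MP}^*_m\colon\{0,1,\dots,m^2\}^m\to\{0,1\}$ is given by $\mathrm{MP}^*_m(t_1,\dots,t_m)=1$ iff $t_i\ge1$ for all $i$, and $\mathrm{MP}^*_m|_{\le w}$ is its restriction to inputs with $t_1+\cdots+t_m\le w$. The threshold degree $\deg_{\pm}(f)$ of $f\colon X\to\{0,1\}$ on a finite $X\subset\mathbb{R}^m$ is the least degree of a real polynomial $p$ with $\operatorname{sign}p(x)=(-1)^{f(x)}$ for all $x\in X$. Logarithms base 2; the constant in $\Omega$ is absolute.
   Formalization: The bound is proved for every m ≥ 2 with one absolute constant; m = 1 is excluded because there m² log m = 0, the restricted domain is the single point 0, and the threshold degree is 0, so no bound c·m with c > 0 can hold. *)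

(* Defs.v *)
From HB Require Import structures.
From mathcomp Require Import all_boot all_order all_algebra.
From mathcomp Require Import boolp classical_sets reals exp.
(* The notations of mpoly clash with those of mathcomp-analysis. *)
From mathcomp.multinomials Require Import -(notations) mpoly.

Set Implicit Arguments.
Unset Strict Implicit.
Unset Printing Implicit Defensive.

Import Order.TTheory GRing.Theory Num.Theory.
Local Open Scope classical_set_scope.
Local Open Scope ring_scope.

(* msize is the total degree plus one (and 0 for the zero polynomial). *)
Definition mpoly_degree (R : realType) (n : nat) (p : mpoly n R) : nat :=
  (mpoly.msize p).-1.

(* Only the values of f on X matter: f stands for a function X -> {0,1}. *)
Definition sign_represents (R : realType) (n : nat) (X : set ('I_n -> R))
    (f : ('I_n -> R) -> bool) (p : mpoly n R) : Prop :=
  forall x, X x -> Num.sg (meval x p) = (-1) ^+ f x.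

Definition sign_degree (R : realType) (n : nat) (X : set ('I_n -> R))
    (f : ('I_n -> R) -> bool) (d : nat) : Prop :=
  exists2 p : mpoly n R, sign_represents X f p & mpoly_degree p = d.

(* The value 0 when no polynomial sign-represents f on X is a dummy: such a
   polynomial always exists when X is finite. *)
Definition threshold_degree (R : realType) (n : nat) (X : set ('I_n -> R))
    (f : ('I_n -> R) -> bool) : nat :=
  if pselect (exists d, `[< sign_degree X f d >]) is left ex_d
  then ex_minn ex_d else 0%N.

Definition log2 (R : realType) (x : R) : R := ln x / ln 2.

Definition MPstar (R : realType) (m : nat) (t : 'I_m -> R) : bool :=
  [forall i, 1 <= t i].

Definition MPstar_dom (R : realType) (m : nat) : set ('I_m -> R) :=
  [set t | forall i, exists2 k : nat, (k <= m ^ 2)%N & t i = k%:R].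

Definition MPstar_dom_le (R : realType) (m : nat) (w : R) : set ('I_m -> R) :=
  [set t | MPstar_dom t /\ \sum_i t i <= w].
Arguments MPstar_dom_le {R} m w.

Definition degpm_MPstar_le (R : realType) (m : nat) (w : R) : nat :=
  threshold_degree (MPstar_dom_le m w) (@MPstar R m).

(* For m = 1 the bound m^2 log m is 0, the restricted domain is {0}, and the
   threshold degree vanishes: a bound c * m with c > 0 can only hold for
   m >= 2. *)
Lemma degpm_MPstar_le1 (R : realType) :
  degpm_MPstar_le 1 ((1 ^ 2)%:R * log2 (1%:R : R)) = 0%N.
Proof.
have d0 : `[< sign_degree (MPstar_dom_le 1 ((1 ^ 2)%:R * log2 (1%:R : R)))
                (@MPstar R 1) 0 >].
  apply/asboolP; exists (mpolyC 1 1); last first.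
    by rewrite /mpoly_degree mmeasureC oner_eq0.
  move=> t [_]; rewrite /log2 ln1 mul0r mulr0 big_ord1 => t0.
  rewrite mevalC sgr1 (_ : MPstar t = false) ?expr0 //.
  apply/forallP => /(_ ord0) t1.
  by have := le_trans t1 t0; rewrite ler10.
rewrite /degpm_MPstar_le /threshold_degree.
case: pselect => // ex_d; case: ex_minnP => d _ /(_ _ d0).
by rewrite leqn0 => /eqP.
Qed.

(* Main.v *)
Require Import Defs.
From HB Require Import structures.
From mathcomp Require Import all_boot all_order all_algebra.
From mathcomp Require Import boolp classical_sets reals sequences exp.
From mathcomp Require Import ring lra zify.
From mathcomp.multinomials Require Import -(notations) mpoly.
Import Order.TTheory GRing.Theory Num.Theory.
Local Open Scope ring_scope.

Set Implicit Arguments.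
Unset Strict Implicit.
Unset Printing Implicit Defensive.

(** Put two positive weights on integer nodes: one on 0 and the 64 j ^ 2 with j
    odd, the other on 1 and the 64 j ^ 2 with j even, j <= n = 2 h, so that
    their moments of order at most h agree; such weights come from the identity
    sum_y (-1) ^ y C(2 n, n + y) Q(y ^ 2) = 0.  They decay like
    exp (- j ^ 2 / 2 n) / j ^ 2, and the first one is concentrated at 0.  The two
    m-fold product weights then give every polynomial p of degree at most h the
    same integral, whereas a sign-representing p should be positive on the
    first grid and negative on the second.  This fails at two kinds of points:
    those of the first grid without a zero coordinate, and those of total weight
    above w = m ^ 2 log m.  At the former, p is bounded through the points
    obtained by zeroing all but at most h coordinates, at the cost of a factor 2
    per zeroed coordinate, which the concentration at 0 outweighs.  At the
    latter, p is bounded through the light grid points of total index at most h,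
    at the cost of a factor m ^ O(m), which the decay of the weights outweighs
    when h is a small multiple of m. *)

(** * Polynomials on product grids *)

(** Each monomial factors over the axes, so a product weight sees [p] only through the
    one-dimensional moments of its factors. *)
Lemma sum_prod_meval (R : comNzRingType) (n : nat) (J : finType)
    (c x : 'I_n -> J -> R) (p : mpoly n R) :
  \sum_(b : {ffun 'I_n -> J}) (\prod_i c i (b i)) * meval (fun i => x i (b i)) p
  = \sum_(mu <- msupp p) mcoeff mu p * \prod_i \sum_j c i j * x i j ^+ mu i.
Proof.
under eq_bigr => b _ do rewrite mevalE mulr_sumr.
rewrite exchange_big /=; apply: eq_bigr => mu _.
rewrite bigA_distr_bigA /= mulr_sumr; apply: eq_bigr => b _.
by rewrite big_split /= mulrCA.
Qed.

Lemma exponent_leq_degree (R : nzRingType) (n d : nat) (p : mpoly n R)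
    (mu : multinom n) :
  (msize p <= d.+1)%N -> mu \in msupp p -> (\sum_i mu i <= d)%N.
Proof.
move=> pd /msize_mdeg_lt mud; rewrite -mdegE -ltnS.
exact: leq_trans mud pd.
Qed.

(* On each axis the evaluation at [u i] is split into functionals indexed by
   [k], the [k]-th one killing all degrees below [rk k]; in the tensor product
   every term of total rank above the degree of [p] vanishes. *)
Lemma meval_tensor_split (R : comNzRingType) (n d : nat) (K J : finType)
    (rk : K -> nat) (a : 'I_n -> K -> J -> R) (x : 'I_n -> J -> R)
    (u : 'I_n -> R) (p : mpoly n R) :
  (msize p <= d.+1)%N ->
  (forall i e, (e <= d)%N -> \sum_k \sum_j a i k j * x i j ^+ e = u i ^+ e) ->
  (forall i k e, (e < rk k)%N -> \sum_j a i k j * x i j ^+ e = 0) ->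
  meval u p =
  \sum_(al : {ffun 'I_n -> K} | (\sum_i rk (al i) <= d)%N)
    \sum_(be : {ffun 'I_n -> J})
      (\prod_i a i (al i) (be i)) * meval (fun i => x i (be i)) p.
Proof.
move=> pd asum akill.
under eq_bigr => al _ do
  rewrite (sum_prod_meval (fun i j => a i (al i) j) x p).
rewrite exchange_big /= mevalE big_seq [RHS]big_seq; apply: eq_bigr => mu mup.
have mud := exponent_leq_degree pd mup.
rewrite -mulr_sumr; congr (_ * _).
have -> : \prod_i u i ^+ mu i
        = \prod_i \sum_k \sum_j a i k j * x i j ^+ mu i.
  apply: eq_bigr => i _; rewrite asum //.
  by apply: leq_trans mud; rewrite (bigD1 i) //= leq_addr.
rewrite bigA_distr_bigA /= (bigID (fun al : {ffun 'I_n -> K} =>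
  (\sum_i rk (al i) <= d)%N)) /= [X in _ + X]big1 ?addr0 // => al.
rewrite -ltnNge => dal.
(* A total rank above [d], hence above the degree of the monomial [mu], forces an axis where the
   rank exceeds the exponent; the functional on that axis kills the factor. *)
have [/forallP le_rk|/forallPn[i]] := boolP [forall i, (rk (al i) <= mu i)%N].
  have : (\sum_i rk (al i) <= \sum_i mu i)%N by apply: leq_sum => i _.
  by move=> /leq_trans /(_ mud); rewrite leqNgt dal.
rewrite -ltnNge => lt_rk.
by rewrite (bigD1 i) //= akill // mul0r.
Qed.

Definition lagrange_basis (R : fieldType) (x : nat -> R) (k l : nat) (y : R) : R :=
  \prod_(j < k | (j : nat) != l) ((y - x j) / (x l - x j)).

Lemma lagrange_interpolation (R : fieldType) (x : nat -> R) (k : nat)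
    (f : {poly R}) (y : R) :
  injective x -> (size f <= k)%N ->
  f.[y] = \sum_(l < k) lagrange_basis x k l y * f.[x l].
Proof.
move=> xi; case: k => [|k] fk.
  by move: fk; rewrite leqn0 size_poly_eq0 => /eqP ->; rewrite big_ord0 horner0.
rewrite {1}(qpoly.lagrange_gen (ltn0Sn k) xi fk) horner_sum.
apply: eq_bigr => l _.
rewrite qpoly.lagrangeE // !hornerM !hornerC mulrC; congr (_ * _).
rewrite /lagrange_basis !horner_prod mulrC prodf_div.
by congr (_ / _); apply: eq_bigr => j _; rewrite hornerXsubC.
Qed.

Lemma lagrange_basis_node (R : fieldType) (x : nat -> R) (k l l' : nat) :
  injective x -> (l < k)%N -> (l' < k)%N ->
  lagrange_basis x k l (x l') = (l == l')%:R.
Proof.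
move=> xi lk l'k; have [<-|ll'] := eqVneq l l'.
  rewrite /lagrange_basis big1 // => j jl; rewrite divff // subr_eq0.
  by apply: contraNneq jl => /xi ->.
rewrite /lagrange_basis (bigD1 (Ordinal l'k)) /=; last by rewrite eq_sym.
by rewrite subrr !mul0r.
Qed.

(** Nodes at mutual distance at least 1 make all denominators harmless, and each of the [k.-1]
    numerators is at most [M]. *)
Lemma norm_lagrange_basis (R : numFieldType) (x : nat -> R) (M : R)
    (k l : nat) (y : R) :
  1 <= M -> (forall j, (j < k)%N -> `|y - x j| <= M) ->
  (forall j, j != l -> 1 <= `|x l - x j|) ->
  (l < k)%N -> `|lagrange_basis x k l y| <= M ^+ k.-1.
Proof.
move=> M1 yM x1 lk; rewrite /lagrange_basis normr_prod.
have M0 : 0 <= M by apply: le_trans M1.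
apply: (@le_trans _ _ (\prod_(j < k | (j : nat) != l) M)).
  apply: ler_prod => j jl; rewrite normr_ge0 /= normrM normfV.
  have x1j := x1 _ jl.
  rewrite ler_pdivrMr ?(lt_le_trans ltr01) //.
  by apply: le_trans (yM j (ltn_ord j)) _; rewrite ler_peMr.
rewrite big_const iter_mulr_1 (_ : #|_| = k.-1) //.
by rewrite (eq_card (B := predC1 (Ordinal lk))) // cardC1 card_ord.
Qed.

(* Telescoping the Lagrange interpolants at the first [k] nodes, [k <= h.+1],
   on every axis reduces any grid point to the simplex of rank at most [h]. *)
Lemma meval_simplex_bound (R : numFieldType) (n h : nat) (x : nat -> R) (M : R)
    (p : mpoly n R) (u : {ffun 'I_n -> 'I_h.+1}) :
  (msize p <= h.+1)%N -> 1 <= M ->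
  (forall j k, (j <= h)%N -> (k <= h)%N -> `|x j - x k| <= M) ->
  (forall j k, j != k -> 1 <= `|x j - x k|) ->
  `|meval (fun i => x (u i)) p| <=
   (h.+1)%:R ^+ n * (2 * M) ^+ h *
   \sum_(be : {ffun 'I_n -> 'I_h.+1} | (\sum_i be i <= h)%N)
     `|meval (fun i => x (be i)) p|.
Proof.
move=> ph M1 xM x1.
have M0 : 0 <= M by apply: le_trans M1.
have xi : injective x.
  move=> j k xjk; apply/eqP; apply: contraT => /x1.
  by rewrite xjk subrr normr0 ler10.
(* [lam k] interpolates at the first [k] nodes and [a i k] is the increment from [k] to [k.+1]
   nodes: it kills degrees below [k], and the increments add up to interpolation at all nodes, which
   is exact at [x (u i)]. *)
pose lam k l y := if (l < k)%N then lagrange_basis x k l y else 0.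
pose a (i : 'I_n) (k l : 'I_h.+1) := lam k.+1 l (x (u i)) - lam k l (x (u i)).
have lam_interp k y e : (k <= h.+1)%N -> (e < k)%N ->
    \sum_(l < h.+1) lam k l y * x l ^+ e = y ^+ e.
  move=> kh ek.
  have := lagrange_interpolation y xi (f := 'X^e) (k := k).
  rewrite size_polyXn => /(_ ek); rewrite hornerXn => ->.
  rewrite (big_ord_widen _ (fun l => lagrange_basis x k l y * 'X^e.[x l]) kh).
  rewrite [RHS]big_mkcond; apply: eq_bigr => l _; rewrite /lam hornerXn.
  by case: ifP; rewrite ?mul0r.
have a_supp i (k l : 'I_h.+1) : (k < l)%N -> a i k l = 0.
  by move=> kl; rewrite /a /lam ltnS leqNgt kl /= ltnNge (ltnW kl) subrr.
(* For [k > 0] the two interpolants contribute at most [M ^+ k + M ^+ k.-1], which is below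
   [(2 * M) ^+ k]; for [k = 0] the second one is 0. *)
have a_norm i k l : `|a i k l| <= (2 * M) ^+ k.
  have lamb (q : nat) : (q <= h.+1)%N -> `|lam q l (x (u i))| <= M ^+ q.-1.
    move=> qh; rewrite /lam; case: ifP => lq; last by rewrite normr0 exprn_ge0.
    apply: norm_lagrange_basis => // [j jq|j jl]; last by rewrite x1 // eq_sym.
    by apply: xM; [rewrite -ltnS | rewrite -ltnS (leq_trans jq)].
  case: (posnP k) => [k0|k0].
    rewrite /a k0 expr0 {2}/lam ltn0 subr0.
    by rewrite (le_trans (lamb 1%N _)).
  rewrite /a (le_trans (ler_normB _ _)) //.
  have := lerD (lamb k.+1 (ltn_ord k)) (lamb k (ltnW (ltn_ord k))).
  move=> /le_trans -> //.
  rewrite exprMn /= (@le_trans _ _ (M ^+ k + M ^+ k)) //.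
    by rewrite lerD2l // ler_weXn2l // leq_pred.
  rewrite -mulr2n -[M ^+ k *+ 2]mulr_natl ler_wpM2r ?exprn_ge0 //.
  by rewrite -[leLHS]expr1 ler_weXn2l ?ler1n.
rewrite (@meval_tensor_split _ _ h _ _ (fun k : 'I_h.+1 => k : nat) a
  (fun _ l => x l) _ _ ph); first last.
- move=> i k e ek; under eq_bigr => l _ do rewrite mulrBl.
  rewrite sumrB !lam_interp ?subrr //; [exact: ltnW|exact: ltnW].
- move=> i e eh; rewrite exchange_big /=.
  under eq_bigr => l _ do rewrite -mulr_suml.
  rewrite (bigD1 (u i)) //= [X in _ + X]big1 ?addr0 => [|l lu].
    rewrite -(big_mkord xpredT (fun k => lam k.+1 (u i) (x (u i))
      - lam k (u i) (x (u i)))) telescope_sumr // /lam ltn0 subr0 ltn_ord.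
    by rewrite lagrange_basis_node // eqxx mul1r.
  rewrite -(big_mkord xpredT (fun k => lam k.+1 l (x (u i))
      - lam k l (x (u i)))) telescope_sumr // /lam ltn0 subr0 ltn_ord.
  rewrite lagrange_basis_node // (_ : (l : nat) == u i = false) ?mul0r //.
  exact/negbTE.
apply: (le_trans (ler_norm_sum _ _ _)).
have -> : (h.+1)%:R ^+ n = \sum_(al : {ffun 'I_n -> 'I_h.+1}) (1 : R).
  by rewrite sumr_const card_ffun !card_ord -natrX.
rewrite -mulrA mulr_suml big_mkcond; apply: ler_sum => al _.
have S0 : 0 <= \sum_(be : {ffun 'I_n -> 'I_h.+1} | (\sum_i be i <= h)%N)
    `|meval (fun i => x (be i)) p| by apply: sumr_ge0.
case: ifP => alh; last by rewrite mul1r mulr_ge0 ?exprn_ge0 ?mulr_ge0.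
apply: (le_trans (ler_norm_sum _ _ _)).
rewrite mul1r mulr_sumr [leRHS]big_mkcond; apply: ler_sum => be _.
rewrite normrM normr_prod.
(* By [a_supp] only the [be] below [al] survive, and these have rank at most [h] as well. *)
have [/forallP le_be|/forallPn[i]] := boolP [forall i, (be i <= al i)%N].
  rewrite (leq_trans (leq_sum _ (fun i _ => le_be i)) alh).
  rewrite ler_wpM2r //.
  apply: (@le_trans _ _ (\prod_i (2 * M) ^+ al i)).
    by apply: ler_prod => i _; rewrite normr_ge0 a_norm.
  rewrite -expr_sum.
  by rewrite ler_weXn2l // (le_trans M1) // ler_peMl ?ler1n.
rewrite -ltnNge => /a_supp a0.
rewrite (bigD1 i) //= a0 normr0 !mul0r.
by case: ifP => // _; rewrite mulr_ge0 ?exprn_ge0 ?mulr_ge0.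
Qed.

Definition mask (n h : nat) (u : {ffun 'I_n -> 'I_h.+1})
    (be : {ffun 'I_n -> bool}) : {ffun 'I_n -> 'I_h.+1} :=
  [ffun i => if be i then u i else ord0].

(** On each axis, evaluation at [x (u i)] is evaluation at [x 0] (rank 0) plus a difference (rank
    1), and terms with more than [d] differences vanish. A kept coordinate comes from the difference
    only; a zeroed one comes from both parts, hence the factor 2. *)
Lemma meval_mask_bound (R : numFieldType) (n h d : nat) (x : nat -> R)
    (p : mpoly n R) (u : {ffun 'I_n -> 'I_h.+1})
    (g : {ffun 'I_n -> 'I_h.+1} -> R) :
  (msize p <= d.+1)%N -> (forall v, 0 <= g v) ->
  (forall be : {ffun 'I_n -> bool}, (\sum_i be i <= d)%N ->
     `|meval (fun i => x (mask u be i)) p| <= g (mask u be)) ->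
  `|meval (fun i => x (u i)) p| <=
   \sum_(be : {ffun 'I_n -> bool})
     (\prod_i (if be i then 1 else 2)) * g (mask u be).
Proof.
move=> pd g0 gP.
pose a (i : 'I_n) (k j : bool) : R :=
  if k then (if j then 1 else -1) else (if j then 0 else 1).
pose xx i (j : bool) := if j then x (u i) else x 0%N.
rewrite (@meval_tensor_split _ _ d _ _ (fun k : bool => k : nat) a xx _ _ pd);
  first last.
- move=> i [|] [|e] //= _; rewrite big_bool /a /xx /= !expr0; ring.
- by move=> i e _; rewrite !big_bool /a /xx /=; ring.
apply: (le_trans (ler_norm_sum _ _ _)).
apply: (@le_trans _ _ (\sum_(al : {ffun 'I_n -> bool})
    \sum_(be : {ffun 'I_n -> bool})
      (\prod_i `|a i (al i) (be i)|) * g (mask u be))).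
  rewrite big_mkcond; apply: ler_sum => al _.
  case: ifP => ald; last first.
    by apply: sumr_ge0 => be _; rewrite mulr_ge0 ?prodr_ge0.
  apply: (le_trans (ler_norm_sum _ _ _)); apply: ler_sum => be _.
  rewrite normrM normr_prod.
  have -> : meval (fun i => xx i (be i)) p
          = meval (fun i => x (mask u be i)) p.
    by congr meval; apply: funext => i; rewrite /xx /mask ffunE; case: (be i).
  have [/forallP le_be|/forallPn[i]] := boolP [forall i, (be i <= al i)%N].
    rewrite ler_wpM2l ?prodr_ge0 // gP // (leq_trans _ ald) //.
    by apply: leq_sum => i _.
  rewrite (bigD1 i) //= /a; case: (be i) (al i) => [] [] //= _.
  by rewrite normr0 !mul0r.
rewrite exchange_big /=; apply: ler_sum => be _.
rewrite -mulr_suml ler_wpM2r //.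
rewrite -(bigA_distr_bigA (fun i k => `|a i k (be i)|)) /=.
rewrite le_eqVlt; apply/orP; left; apply/eqP; apply: eq_bigr => i _.
by rewrite big_bool /a /=; case: (be i); rewrite ?normrN ?normr0 ?normr1; ring.
Qed.

(** Regrouping by the masked point [v]: a nonzero [v i] determines [u i] and the mask at [i], while
    [v i = 0] leaves [u i] free among the nonzero indices. *)
Lemma sum_mask (R : comNzRingType) (n h : nat) (a : 'I_h.+1 -> R)
    (g : {ffun 'I_n -> 'I_h.+1} -> R) :
  \sum_(u : {ffun 'I_n -> 'I_h.+1} | [forall i, u i != ord0])
    (\prod_i a (u i)) * \sum_(be : {ffun 'I_n -> bool})
      (\prod_i (if be i then 1 else 2)) * g (mask u be)
  = \sum_(v : {ffun 'I_n -> 'I_h.+1}) (\prod_i (if v i == ord0 then 2 * \sum_(k | k != ord0) a k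
      else a (v i))) * g v.
Proof.
(* The share of the choice [u i = k], [be i = b] in the factor of axis [i]; the two indicators let
   [u] and [be] range freely, so that the sums factor over the axes. *)
pose f (v : {ffun 'I_n -> 'I_h.+1}) i (k : 'I_h.+1) (b : bool) : R :=
  (k != ord0)%:R * ((if b then k else ord0) == v i)%:R *
  (a k * (if b then 1 else 2)).
transitivity (\sum_(v : {ffun 'I_n -> 'I_h.+1}) \sum_(u : {ffun 'I_n -> 'I_h.+1})
    \sum_(be : {ffun 'I_n -> bool}) (\prod_i f v i (u i) (be i)) * g v).
  rewrite exchange_big /= big_mkcond; apply: eq_bigr => u _.
  case: ifPn => [/forallP u0|/forallPn[i ui]]; last first.
    rewrite big1 // => v _; rewrite big1 // => be _.
    by rewrite (bigD1 i) //= /f (negbTE ui) !mul0r.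
  rewrite mulr_sumr exchange_big /=; apply: eq_bigr => be _.
  rewrite (bigD1 (mask u be)) //= [X in _ + X]big1 ?addr0 => [|v vm].
    rewrite mulrA; congr (_ * _); rewrite -big_split /=; apply: eq_bigr => i _.
    by rewrite /f u0 ffunE eqxx !mul1r.
  have [i mi] : exists i, mask u be i != v i.
    apply/existsP; rewrite -negb_forall; apply: contraNN vm => /forallP mv.
    by apply/eqP/ffunP => i; rewrite (eqP (mv i)).
  rewrite (bigD1 i) //= /f; move: mi; rewrite ffunE => /negbTE ->.
  by rewrite mulr0 !mul0r.
apply: eq_bigr => v _.
have sum_be (u : {ffun 'I_n -> 'I_h.+1}) :
    \sum_(be : {ffun 'I_n -> bool}) (\prod_i f v i (u i) (be i)) * g v
    = (\prod_i \sum_b f v i (u i) b) * g v.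
  by rewrite bigA_distr_bigA mulr_suml.
rewrite (eq_bigr _ (fun u _ => sum_be u)).
rewrite -mulr_suml; congr (_ * _).
rewrite -(bigA_distr_bigA (fun i k => \sum_b f v i k b)) /=.
apply: eq_bigr => i _.
under eq_bigr => k _ do rewrite big_bool /f /=.
have [vi|vi] := eqVneq (v i) ord0.
  rewrite mulr_sumr [RHS]big_mkcond; apply: eq_bigr => k _.
  by rewrite vi; case: (eqVneq k ord0) => _ /=; rewrite ?eqxx /=; ring.
rewrite (bigD1 (v i)) //= [X in _ + X]big1 ?addr0 => [|k kv].
  by rewrite vi eqxx /=; ring.
by rewrite (negbTE kv) /=; ring.
Qed.

(** By [sum_mask], a zero coordinate of [v] carries twice the mass of the nonzero indices, at most
    [a ord0 / 4]. A good [v] has such a coordinate, which provides the factor [4^-1]; further ones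
    cost nothing. *)
Lemma sum_nonzero_bound (R : realFieldType) (n h d : nat) (x : nat -> R)
    (a : 'I_h.+1 -> R) (p : mpoly n R)
    (good : pred {ffun 'I_n -> 'I_h.+1}) (B : pred {ffun 'I_n -> 'I_h.+1}) :
  (msize p <= d.+1)%N -> (d < n)%N -> (forall k, 0 <= a k) ->
  \sum_(k | k != ord0) a k <= a ord0 / 8 ->
  (forall v, good v -> exists i, v i == ord0) ->
  (forall u, B u -> forall i, u i != ord0) ->
  (forall u (be : {ffun 'I_n -> bool}), B u -> (exists i, ~~ be i) -> good (mask u be)) ->
  \sum_(u | B u) (\prod_i a (u i)) * `|meval (fun i => x (u i)) p| <=
  4^-1 * \sum_(v | good v) (\prod_i a (v i)) * `|meval (fun i => x (v i)) p|.
Proof.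
move=> pd dn a0 a8 good0 Bn0 Bgood.
pose g (v : {ffun 'I_n -> 'I_h.+1}) := if good v then `|meval (fun i => x (v i)) p| else 0.
have g0 v : 0 <= g v by rewrite /g; case: ifP.
apply: (@le_trans _ _ (\sum_(u : {ffun 'I_n -> 'I_h.+1} | [forall i, u i != ord0])
    (\prod_i a (u i)) * \sum_(be : {ffun 'I_n -> bool})
      (\prod_i (if be i then 1 else 2)) * g (mask u be))).
  rewrite big_mkcond [leRHS]big_mkcond; apply: ler_sum => u _.
  have S0 : 0 <= \sum_(be : {ffun 'I_n -> bool})
      (\prod_i (if be i then 1 else 2)) * g (mask u be).
    apply: sumr_ge0 => be _; rewrite mulr_ge0 // prodr_ge0 // => i _.
    by case: ifP.
  case: ifP => Bu; last first.
    by case: ifP => // _; rewrite mulr_ge0 ?prodr_ge0.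
  have -> : [forall i, u i != ord0] by apply/forallP; apply: Bn0.
  rewrite ler_wpM2l ?prodr_ge0 //.
  apply: (meval_mask_bound pd) => // be bed; rewrite /g Bgood //.
  (* At most [d < n] coordinates are kept, so one of them is zeroed. *)
  apply/existsP; rewrite -negb_forall; apply: contraTN bed => /forallP be1.
  rewrite -ltnNge (leq_trans dn) //.
  rewrite (eq_bigr (fun=> 1%N)) => [|i _]; last by rewrite be1.
  by rewrite sum1_card card_ord.
rewrite sum_mask [leRHS]mulr_sumr [leRHS]big_mkcond; apply: ler_sum => v _.
rewrite /g; case: ifP => gv; last by rewrite mulr0.
rewrite mulrA ler_wpM2r //.
have [i vi] := good0 _ gv.
rewrite (bigD1 i) //= [in leRHS](bigD1 i) //= vi (eqP vi) mulrA.
apply: ler_pM.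
- by rewrite mulr_ge0 // sumr_ge0.
- by apply: prodr_ge0 => j _; case: ifP => // _; rewrite mulr_ge0 // sumr_ge0.
- by lra.
apply: ler_prod => j _; case: eqP => [->|_]; last by rewrite a0 lexx.
by rewrite mulr_ge0 ?sumr_ge0 //=; have := a0 ord0; lra.
Qed.

(** In the last hypothesis, one factor [(h.+1)%:R ^+ n] pays for the constant of
    [meval_simplex_bound], the other for the number of heavy points. *)
Lemma sum_heavy_bound (R : realFieldType) (n h : nat) (x : nat -> R) (M : R)
    (a : 'I_h.+1 -> R) (p : mpoly n R)
    (heavy : pred {ffun 'I_n -> 'I_h.+1}) :
  (msize p <= h.+1)%N -> 1 <= M -> (forall k, 0 <= a k) ->
  (forall j k, (j <= h)%N -> (k <= h)%N -> `|x j - x k| <= M) ->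
  (forall j k, j != k -> 1 <= `|x j - x k|) ->
  (forall u be : {ffun 'I_n -> 'I_h.+1}, heavy u -> (\sum_i be i <= h)%N ->
     4 * ((h.+1)%:R ^+ n * ((h.+1)%:R ^+ n * (2 * M) ^+ h)) * \prod_i a (u i)
       <= \prod_i a (be i)) ->
  \sum_(u | heavy u) (\prod_i a (u i)) * `|meval (fun i => x (u i)) p| <=
  4^-1 * \sum_(be : {ffun 'I_n -> 'I_h.+1} | (\sum_i be i <= h)%N)
    (\prod_i a (be i)) * `|meval (fun i => x (be i)) p|.
Proof.
move=> ph M1 a0 xM x1 heavyP.
set S := (X in _ <= _ * X).
have S0 : 0 <= S.
  by apply: sumr_ge0 => be _; rewrite mulr_ge0 ?prodr_ge0.
set N : R := (h.+1)%:R ^+ n.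
have N0 : 0 < N by rewrite exprn_gt0 ?ltr0n.
have -> : 4^-1 * S = \sum_(u : {ffun 'I_n -> 'I_h.+1}) (4 * N)^-1 * S.
  rewrite sumr_const card_ffun !card_ord -[RHS]mulr_natl natrX -/N.
  by field; rewrite gt_eqF.
rewrite big_mkcond; apply: ler_sum => u _; case: ifP => hu; last first.
  by rewrite mulr_ge0 // invr_ge0 mulr_ge0 // ltW.
rewrite ler_pdivlMl ?mulr_gt0 //.
have P0 : 0 <= \prod_i a (u i) by apply: prodr_ge0.
have N4 : 0 <= 4 * N by rewrite mulr_ge0 // ltW.
have bound := meval_simplex_bound u ph M1 xM x1.
apply: le_trans (ler_wpM2l N4 (ler_wpM2l P0 bound)) _.
rewrite !mulr_sumr; apply: ler_sum => be beh.
rewrite !mulrA ler_wpM2r // (le_trans _ (heavyP _ _ hu beh)) //.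
by rewrite le_eqVlt -/N; apply/orP; left; apply/eqP; ring.
Qed.

(* Both sides of the moment identity for the product weights are estimated:
   the only terms of the wrong sign are the grid points outside [lightp] and
   [lightm] and the positive-side points without a zero coordinate. *)
Lemma no_low_degree_sign (R : realFieldType) (n h : nat) (xp xm : nat -> R)
    (M : R) (ap am : 'I_h.+1 -> R) (p : mpoly n R)
    (lightp lightm : pred {ffun 'I_n -> 'I_h.+1}) :
  (h < n)%N -> (msize p <= h.+1)%N -> 1 <= M ->
  (forall k, 0 < ap k) -> (forall k, 0 < am k) ->
  (forall e, (e <= h)%N ->
     \sum_k ap k * xp k ^+ e = \sum_k am k * xm k ^+ e) ->
  \sum_(k | k != ord0) ap k <= ap ord0 / 8 ->
  (forall j k, (j <= h)%N -> (k <= h)%N -> `|xp j - xp k| <= M) ->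
  (forall j k, j != k -> 1 <= `|xp j - xp k|) ->
  (forall j k, (j <= h)%N -> (k <= h)%N -> `|xm j - xm k| <= M) ->
  (forall j k, j != k -> 1 <= `|xm j - xm k|) ->
  (forall u be, lightp u -> lightp (mask u be)) ->
  (forall be : {ffun 'I_n -> 'I_h.+1}, (\sum_i be i <= h)%N -> lightp be) ->
  (forall be : {ffun 'I_n -> 'I_h.+1}, (\sum_i be i <= h)%N -> lightm be) ->
  (forall u be : {ffun 'I_n -> 'I_h.+1}, ~~ lightp u -> (\sum_i be i <= h)%N ->
     4 * ((h.+1)%:R ^+ n * ((h.+1)%:R ^+ n * (2 * M) ^+ h)) * \prod_i ap (u i)
       <= \prod_i ap (be i)) ->
  (forall u be : {ffun 'I_n -> 'I_h.+1}, ~~ lightm u -> (\sum_i be i <= h)%N ->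
     4 * ((h.+1)%:R ^+ n * ((h.+1)%:R ^+ n * (2 * M) ^+ h)) * \prod_i am (u i)
       <= \prod_i am (be i)) ->
  (forall u, lightp u -> (exists i, u i == ord0) ->
     0 < meval (fun i => xp (u i)) p) ->
  (forall u, lightp u -> (forall i, u i != ord0) ->
     meval (fun i => xp (u i)) p < 0) ->
  (forall u, lightm u -> meval (fun i => xm (u i)) p < 0) ->
  False.
Proof.
move=> hn ph M1 ap0 am0 mom ap8 xpM xp1 xmM xm1 maskp simp simm hvp hvm
  posp negp negm.
have ap0' k : 0 <= ap k by apply: ltW.
have am0' k : 0 <= am k by apply: ltW.
pose Wp (u : {ffun 'I_n -> 'I_h.+1}) := \prod_i ap (u i).
pose Wm (u : {ffun 'I_n -> 'I_h.+1}) := \prod_i am (u i).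
pose Pp (u : {ffun 'I_n -> 'I_h.+1}) := meval (fun i => xp (u i)) p.
pose Pm (u : {ffun 'I_n -> 'I_h.+1}) := meval (fun i => xm (u i)) p.
have Wp0 u : 0 <= Wp u by apply: prodr_ge0.
have Wm0 u : 0 <= Wm u by apply: prodr_ge0.
have moments : \sum_u Wp u * Pp u = \sum_u Wm u * Pm u.
  rewrite /Wp /Pp /Wm /Pm.
  rewrite (sum_prod_meval (fun _ => ap) (fun _ k => xp k)).
  rewrite (sum_prod_meval (fun _ => am) (fun _ k => xm k)).
  rewrite big_seq [RHS]big_seq; apply: eq_bigr => mu mup; congr (_ * _).
  apply: eq_bigr => i _; apply: mom.
  by apply: leq_trans (exponent_leq_degree ph mup); rewrite (bigD1 i) //= leq_addr.
pose zero (u : {ffun 'I_n -> 'I_h.+1}) := [exists i, u i == ord0].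
pose good u := lightp u && zero u.
pose bad u := lightp u && ~~ zero u.
pose G := \sum_(u | good u) Wp u * `|Pp u|.
pose B := \sum_(u | bad u) Wp u * `|Pp u|.
pose Hp := \sum_(u | ~~ lightp u) Wp u * `|Pp u|.
pose N := \sum_(u | lightm u) Wm u * `|Pm u|.
pose Hm := \sum_(u | ~~ lightm u) Wm u * `|Pm u|.
have leB : B <= 4^-1 * G.
  apply: (@sum_nonzero_bound _ _ _ _ xp ap p good bad ph hn ap0' ap8).
  - by move=> v /andP[_ /existsP].
  - by move=> u /andP[_]; rewrite negb_exists => /forallP.
  - move=> u be /andP[lu _] [i bei]; rewrite /good maskp //=.
    by apply/existsP; exists i; rewrite ffunE (negbTE bei).
have leHp : Hp <= 4^-1 * G.
  apply: le_trans (sum_heavy_bound ph M1 ap0' xpM xp1 hvp) _.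
  rewrite ler_pM2l ?invr_gt0 //.
  rewrite [leLHS]big_mkcond /G [leRHS]big_mkcond; apply: ler_sum => be _.
  case: ifP => beh; last by case: ifP => // _; rewrite mulr_ge0.
  (* Rank at most [h < n] leaves a zero coordinate, so the simplex consists of good points. *)
  have zbe : zero be.
    apply: contraTT beh; rewrite negb_exists => /forallP be0.
    rewrite -ltnNge (leq_trans hn) // -[leqLHS]card_ord -sum1_card.
    by apply: leq_sum => i _; rewrite lt0n; exact: be0.
  by rewrite /good simp //= zbe.
have leHm : Hm <= 4^-1 * N.
  apply: le_trans (sum_heavy_bound ph M1 am0' xmM xm1 hvm) _.
  rewrite ler_pM2l ?invr_gt0 //.
  rewrite [leLHS]big_mkcond /N [leRHS]big_mkcond; apply: ler_sum => be _.
  case: ifP => beh; last by case: ifP => // _; rewrite mulr_ge0.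
  by rewrite simm.
have geP : G - B - Hp <= \sum_u Wp u * Pp u.
  rewrite (bigID lightp) /= (bigID zero) /= -addrA -addrA.
  rewrite -!opprD; apply: lerD; last rewrite opprD; [|apply: lerD].
  - rewrite /G le_eqVlt; apply/orP; left; apply/eqP; apply: eq_bigr => u.
    by move=> /andP[lu /existsP zu]; rewrite gtr0_norm // posp.
  - rewrite /B -sumrN; apply: ler_sum => u /andP[lu].
    rewrite negb_exists => /forallP nz; rewrite ltr0_norm ?negp //.
    by rewrite mulrN opprK.
  - rewrite /Hp -sumrN; apply: ler_sum => u _; rewrite -mulrN ler_wpM2l //.
    by rewrite lerNl ler_normr lexx orbT.
have leM : \sum_u Wm u * Pm u <= - N + Hm.
  rewrite (bigID lightm) /=; apply: lerD.
    rewrite /N -sumrN; apply: ler_sum => u lu; rewrite ltr0_norm ?negm //.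
    by rewrite mulrN opprK.
  by apply: ler_sum => u _; rewrite ler_wpM2l // ler_norm.
have N0 : 0 <= N by apply: sumr_ge0 => u _; rewrite mulr_ge0.
(* The origin of the grid is light and has a zero coordinate. *)
have G0 : 0 < G.
  have n0 : (0 < n)%N by apply: leq_trans hn.
  pose o : {ffun 'I_n -> 'I_h.+1} := [ffun=> ord0].
  have lo : lightp o by apply: simp; rewrite big1 // => i _; rewrite ffunE.
  have zo : exists i, o i == ord0 by exists (Ordinal n0); rewrite ffunE.
  rewrite /G (bigD1 o) /=; last by rewrite /good lo; apply/existsP.
  rewrite ltr_wpDr //; first by apply: sumr_ge0 => u _; rewrite mulr_ge0.
  by rewrite mulr_gt0 ?normr_gt0 ?gt_eqF ?prodr_gt0 // posp.
(* [G / 2 <= G - B - Hp <= - N + Hm <= 0], against [0 < G]. *)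
lra.
Qed.

(** * Weights with matching moments *)

(** The difference of powers [('X + 1) ^+ i - 'X^i] is [('X + 1) - 'X = 1] times a sum of terms of
    degree [i.-1], so a forward difference lowers the degree. *)
Lemma size_shift_sub (R : nzRingType) (q : {poly R}) :
  (size (q \Po ('X + 1) - q)%R <= (size q).-1)%N.
Proof.
rewrite comp_polyE -[X in _ - X]coefK poly_def -sumrB.
apply: (leq_trans (size_sum _ _ _)); apply/bigmax_leqP => i _.
rewrite -scalerBr (leq_trans (size_scale_leq _ _)) //.
have -> : ('X + 1) ^+ i - 'X^i
    = \sum_(j < i) ('X + 1) ^+ (i.-1 - j) * 'X^j :> {poly R}.
  rewrite subrXX_comm; last exact: commr_polyX.
  by rewrite (addrC 'X) addrK mul1r.
apply: (leq_trans (size_sum _ _ _)); apply/bigmax_leqP => j _.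
apply: (leq_trans (size_polyMleq _ _)); rewrite size_polyXn addnS /=.
have : (size (('X + 1) ^+ (i.-1 - j)%N : {poly R})%R <= (i.-1 - j).+1)%N.
  by rewrite (leq_trans (size_poly_exp_leq _ _)) // -polyC1 size_XaddC mul1n.
move=> /leq_add /(_ (leqnn j)) /leq_trans; apply.
have ji := ltn_ord j; have iq := ltn_ord i.
rewrite addSn subnK; first by rewrite (ltn_predK ji) -ltnS (ltn_predK iq).
by rewrite -ltnS (ltn_predK ji).
Qed.

(** Up to sign the sum is the [N]-th finite difference of [q] at 0; Pascal's rule trades one unit of
    [N] for one forward difference of [q]. *)
Lemma alternating_binomial_sum (R : comNzRingType) (N : nat) (q : {poly R}) :
  (size q <= N)%N ->
  \sum_(i < N.+1) (-1) ^+ i * 'C(N, i)%:R * q.[i%:R] = 0.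
Proof.
elim: N q => [|N IH] q qN.
  move: qN; rewrite leqn0 size_poly_eq0 => /eqP ->.
  by rewrite big1 // => i _; rewrite horner0 mulr0.
have := IH (q \Po ('X + 1) - q).
have -> : (size (q \Po ('X + 1) - q)%R <= N)%N.
  by apply: leq_trans (size_shift_sub q) _; rewrite -subn1 leq_subLR add1n.
move=> /(_ isT) IHq.
rewrite big_ord_recl /=.
under eq_bigr => i _ do rewrite /bump add1n binS natrD mulrDr mulrDl.
rewrite big_split /= addrA.
have -> : (-1) ^+ 0 * 'C(N.+1, 0)%:R * q.[0%:R] +
   \sum_(i < N.+1) (-1) ^+ i.+1 * 'C(N, i.+1)%:R * q.[i.+1%:R]
  = \sum_(i < N.+1) (-1) ^+ i * 'C(N, i)%:R * q.[i%:R].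
  rewrite big_ord_recr /= (@bin_small N N.+1) // mulr0n mulr0 mul0r addr0.
  by rewrite [RHS]big_ord_recl /= !bin0.
rewrite -big_split /=; apply: oppr_inj; rewrite oppr0 -[RHS]IHq -sumrN.
apply: eq_bigr => i _.
rewrite hornerD hornerN horner_comp hornerD hornerX hornerC natr1 exprS.
ring.
Qed.

(** This is [alternating_binomial_sum] for [Q ((X - n) ^ 2)], of degree below [2 n], folded around
    the centre: the indices [n - j] and [n + j] contribute equally. *)
Lemma folded_binomial_sum (R : idomainType) (n : nat) (Q : {poly R}) :
  (size Q <= n)%N ->
  'C(n.*2, n)%:R * Q.[0] +
  2 * \sum_(j < n) (-1) ^+ j.+1 * 'C(n.*2, n + j.+1)%:R * Q.[j.+1%:R ^+ 2] = 0.
Proof.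
move=> Qn; pose q := Q \Po (('X - n%:R%:P) ^+ 2).
have qn : (size q <= n.*2)%N.
  have := size_comp_poly Q (('X - n%:R%:P) ^+ 2).
  rewrite -/q size_exp_XsubC.
  have aux (a b : nat) : (a <= n -> 0 < n -> b.-1 = (a.-1 * 2) ->
    b <= n.*2)%N by lia.
  case: (posnP n) => [n0 _|n0]; last exact: aux Qn n0.
  move: Qn; rewrite n0 leqn0 size_poly_eq0 => /eqP Q0.
  by rewrite /q Q0 comp_poly0 size_poly0.
pose F i : R := (-1) ^+ i * 'C(n.*2, i)%:R * q.[i%:R].
have /= := alternating_binomial_sum qn; rewrite -/F.
rewrite -(big_mkord xpredT F) (_ : n.*2.+1 = n + n.+1)%N; last by lia.
rewrite big_mkord big_split_ord /= big_ord_recl /= addn0.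
rewrite (reindex_inj rev_ord_inj) /= => sumF.
have Fhi (j : 'I_n) : F (n + j.+1)%N = (-1) ^+ n *
    ((-1) ^+ j.+1 * 'C(n.*2, n + j.+1)%:R * Q.[j.+1%:R ^+ 2]).
  rewrite /F horner_comp horner_exp.
  rewrite hornerXsubC natrD addrAC subrr add0r.
  by rewrite exprD !mulrA.
have Flo (j : 'I_n) : F (n - j.+1)%N = F (n + j.+1)%N.
  have jn := ltn_ord j.
  rewrite /F !horner_comp !horner_exp !hornerXsubC natrB // natrD.
  have -> : 'C(n.*2, n - j.+1) = 'C(n.*2, n + j.+1).
    by rewrite -(bin_sub (m := n + j.+1)); [congr ('C(_, _)); lia | lia].
  have -> : (-1) ^+ (n - j.+1) = (-1) ^+ (n + j.+1) :> R.
    by rewrite -signr_odd -[RHS]signr_odd; congr ((-1) ^+ _); lia.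
  by congr (_ * _.[_]); ring.
apply: (mulfI (_ : (-1) ^+ n != 0)); first by rewrite signr_eq0.
rewrite mulr0 -[RHS]sumF (eq_bigr _ (fun j _ => Flo j)).
have -> : F n = (-1) ^+ n * ('C(n.*2, n)%:R * Q.[0]).
  by rewrite /F horner_comp horner_exp hornerXsubC subrr expr0n mulrA.
have -> : \sum_(j < n) F (n + j.+1)%N = (-1) ^+ n *
    \sum_(j < n) (-1) ^+ j.+1 * 'C(n.*2, n + j.+1)%:R * Q.[j.+1%:R ^+ 2].
  by rewrite mulr_sumr; apply: eq_bigr => j _; exact: Fhi.
ring.
Qed.

Definition binratio (R : fieldType) (n j : nat) : R :=
  'C(n.*2, n + j)%:R / 'C(n.*2, n)%:R.

Lemma central_bin_gt0 (R : numFieldType) (n : nat) :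
  0 < ('C(n.*2, n)%:R : R).
Proof. by rewrite ltr0n bin_gt0 -addnn leq_addr. Qed.

Lemma binratio0 (R : numFieldType) (n : nat) : binratio R n 0 = 1.
Proof. by rewrite /binratio addn0 divff // gt_eqF ?central_bin_gt0. Qed.

Lemma binratioS (R : numFieldType) (n j : nat) : (j < n)%N ->
  binratio R n j.+1 = binratio R n j * ((n - j)%:R / (n + j.+1)%:R).
Proof.
move=> jn; rewrite /binratio.
have C0 := central_bin_gt0 R n.
have : ((n + j.+1)%:R * 'C(n.*2, n + j.+1)%:R = (n - j)%:R * 'C(n.*2, n + j)%:R :> R).
  rewrite -!natrM addnS mul_bin_left; congr (_ * _)%:R; lia.
have D0 : (n + j.+1)%:R != 0 :> R by rewrite pnatr_eq0 addnS.
move=> E; apply: (mulfI D0); rewrite mulrA E.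
have {}C0 : 'C(n.*2, n)%:R != 0 :> R by rewrite gt_eqF.
move: D0 C0; move: (n + j.+1)%:R 'C(n.*2, n)%:R (n - j)%:R => D C nj D0 C0.
by field; rewrite D0 C0.
Qed.

(** [(n - j) / (n + j + 1) = 1 - (2 j + 1) / (n + j + 1) <= exp (- (2 j + 1) / (2 n))] for [j < n],
    and the odd numbers add up to squares. *)
Lemma binratio_le (R : realType) (n j : nat) : (j <= n)%N ->
  binratio R n j <= expR (- ((j ^ 2)%:R / (n.*2)%:R)).
Proof.
elim: j => [|j IH] jn; first by rewrite binratio0 mul0r oppr0 expR0.
rewrite binratioS //.
have n0 : 0 < (n.*2)%:R :> R by rewrite ltr0n; lia.
have -> : - ((j.+1 ^ 2)%:R / (n.*2)%:R) =
    - ((j ^ 2)%:R / (n.*2)%:R) + - ((j.*2.+1)%:R / (n.*2)%:R) :> R.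
  rewrite -opprD -mulrDl -natrD; congr (- (_%:R / _)); lia.
rewrite expRD ler_pM //.
- by rewrite divr_ge0 // ler0n.
- by rewrite divr_ge0 // ler0n.
- by apply: IH; lia.
apply: le_trans (expR_ge1Dx _).
have d0 : 0 < (n + j.+1)%:R :> R by rewrite ltr0n; lia.
rewrite ler_pdivrMr // mulrDl mul1r mulNr -mulrA.
have : (j.*2.+1)%:R * ((n + j.+1)%:R / (n.*2)%:R) <= (j.*2.+1)%:R :> R.
  by rewrite ler_piMr ?ler0n // ler_pdivrMr // mul1r ler_nat; lia.
have : (n - j)%:R = (n + j.+1)%:R - (j.*2.+1)%:R :> R.
  by rewrite -natrB; [congr _%:R; lia | lia].
rewrite [(n.*2)%:R^-1 * _]mulrC; lra.
Qed.

(** Each factor [(n - j) / (n + j + 1)] with [j < n] is at least [1 / (2 n)]. *)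
Lemma binratio_ge (R : realFieldType) (n j : nat) : (j <= n)%N ->
  (n.*2)%:R ^- j <= binratio R n j.
Proof.
elim: j => [|j IH] jn; first by rewrite binratio0 expr0 invr1.
rewrite binratioS // exprSr invfM ler_pM ?invr_ge0 ?exprn_ge0 ?ler0n //.
  by apply: IH; lia.
have n0 : 0 < (n.*2)%:R :> R by rewrite ltr0n; lia.
have d0 : 0 < (n + j.+1)%:R :> R by rewrite ltr0n; lia.
rewrite ler_pdivlMr // mulrC ler_pdivrMr // -natrM ler_nat.
nia.
Qed.

(** At [k = 0] the truncated predecessor yields the node 0. The factor 64 keeps the mass on the
    other nodes at most [4 / 63 < 1 / 8]. *)
Definition node_pos (k : nat) : nat := 64 * k.*2.-1 ^ 2.

Definition node_neg (k : nat) : nat := if k is 0 then 1 else 64 * k.*2 ^ 2.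

(* The absolute value at the node [64 * j ^ 2] of the dual functional of the
   nodes 0, 1, 64 * 1 ^ 2, .., 64 * n ^ 2 with [n = h.*2], normalized to be 1
   at the node 0. *)
Definition dual_weight (R : fieldType) (h j : nat) : R :=
  2 * binratio R h.*2 j / (64 * j%:R ^+ 2 - 1).

Definition weight_pos (R : fieldType) (h k : nat) : R :=
  if k is 0 then 1 else dual_weight R h k.*2.-1.

(** Index 0 is the node 1; its weight is the one that equates the total masses of the two grids. *)
Definition weight_neg (R : fieldType) (h k : nat) : R :=
  if k is 0 then
    1 + \sum_(i < h) (dual_weight R h i.*2.+1 - dual_weight R h i.*2.+2)
  else dual_weight R h k.*2.

Lemma sum_ord_double (V : nmodType) (h : nat) (F : nat -> V) :
  \sum_(j < h.*2) F j = \sum_(k < h) (F k.*2 + F k.*2.+1).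
Proof.
elim: h => [|h IH]; first by rewrite !big_ord0.
by rewrite doubleS !big_ord_recr /= IH addrA.
Qed.

Lemma dual_denom_gt0 (R : realFieldType) (j : nat) : (0 < j)%N ->
  0 < 64 * j%:R ^+ 2 - 1 :> R.
Proof.
move=> j0; have : 1 <= j%:R ^+ 2 :> R by rewrite -natrX ler1n expn_gt0 j0.
by lra.
Qed.

(** In [folded_binomial_sum] for the divided difference of [X ^ e] at 1, the sign [(-1) ^ j] sorts
    the nodes [64 j ^ 2] into the two grids, and the subtracted values at 1 add up to the weight of
    the node 1. *)
Lemma moments_match (R : realFieldType) (h e : nat) : (e <= h)%N ->
  \sum_(k < h.+1) weight_pos R h k * (node_pos k)%:R ^+ e =
  \sum_(k < h.+1) weight_neg R h k * (node_neg k)%:R ^+ e.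
Proof.
move=> eh; set n := h.*2.
(* With F = X ^ e and Q = (F - F(1)) / (X - 1). *)
pose Q : {poly R} := \poly_(i < e) (64 ^+ i).
have Qn : (size Q <= n)%N by rewrite (leq_trans (size_poly _ _)) // /n; lia.
have QE (y : R) : 64 * y != 1 -> Q.[y] = ((64 * y) ^+ e - 1) / (64 * y - 1).
  move=> y1; have d0 : 64 * y - 1 != 0 by rewrite subr_eq0.
  apply: (mulIf d0); rewrite divfK // subrX1 mulrC; congr (_ * _).
  by rewrite horner_poly; apply: eq_bigr => i _; rewrite exprMn.
have C0 := central_bin_gt0 R n.
have := folded_binomial_sum Qn.
(* The power [0 ^+ e] is the contribution of the node 0, equal to 1 when [e = 0]. *)
have -> : Q.[0] = 1 - 0 ^+ e.
  rewrite QE; last by rewrite mulr0 eq_sym oner_eq0.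
  by rewrite mulr0 sub0r invrN1 mulrN1 opprB.
move=> /(congr1 (fun z => z / 'C(n.*2, n)%:R)); rewrite mul0r mulrDl.
rewrite mulrAC mulfV ?gt_eqF // mul1r.
have -> : 2 * (\sum_(j < n) (-1) ^+ j.+1 * 'C(n.*2, n + j.+1)%:R *
      Q.[j.+1%:R ^+ 2]) / 'C(n.*2, n)%:R
    = \sum_(j < n) (-1) ^+ j.+1 * (dual_weight R h j.+1 *
        ((64 * j.+1 ^ 2)%:R ^+ e - 1)).
  rewrite mulr_sumr mulr_suml; apply: eq_bigr => j _.
  have D0 := @dual_denom_gt0 R j.+1 isT.
  rewrite QE; last by rewrite -subr_eq0 gt_eqF.
  rewrite /dual_weight /binratio -/n natrM natrX.
  move: D0 C0; set D := (_ - 1); set C := 'C(n.*2, n)%:R => D0 C0.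
  by field; rewrite !gt_eqF.
rewrite (sum_ord_double h (fun j => (-1) ^+ j.+1 * (dual_weight R h j.+1 *
        ((64 * j.+1 ^ 2)%:R ^+ e - 1)))).
have -> : \sum_(k < h) ((-1) ^+ k.*2.+1 * (dual_weight R h k.*2.+1 *
        ((64 * k.*2.+1 ^ 2)%:R ^+ e - 1)) +
      (-1) ^+ k.*2.+2 * (dual_weight R h k.*2.+2 *
        ((64 * k.*2.+2 ^ 2)%:R ^+ e - 1)))
   = \sum_(k < h) dual_weight R h k.*2.+2 * (64 * k.*2.+2 ^ 2)%:R ^+ e
   - \sum_(k < h) dual_weight R h k.*2.+1 * (64 * k.*2.+1 ^ 2)%:R ^+ e
   + \sum_(k < h) (dual_weight R h k.*2.+1 - dual_weight R h k.*2.+2).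
  rewrite -sumrB -big_split; apply: eq_bigr => k _ /=.
  rewrite -!(signr_odd _ _.+1) /= odd_double /= expr0 expr1; ring.
rewrite !big_ord_recl /= expr1n mulr1 mul1r => E.
apply/eqP; rewrite -subr_eq0; apply/eqP.
rewrite -[RHS]oppr0 -[in RHS]E /node_pos /= muln0; ring.
Qed.

Lemma binratio_gt0 (R : realFieldType) (n j : nat) : (j <= n)%N ->
  0 < binratio R n j.
Proof.
move=> jn; rewrite divr_gt0 ?central_bin_gt0 // ltr0n bin_gt0; lia.
Qed.

Lemma dual_weight_gt0 (R : realFieldType) (h j : nat) : (0 < j <= h.*2)%N ->
  0 < dual_weight R h j.
Proof.
move=> /andP[j0 jh].
by rewrite divr_gt0 ?dual_denom_gt0 // mulr_gt0 // binratio_gt0.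
Qed.

Lemma dual_weight_le_binratio (R : realFieldType) (h j : nat) :
  (0 < j <= h.*2)%N -> dual_weight R h j <= binratio R h.*2 j.
Proof.
move=> /andP[j0 jh]; rewrite ler_pdivrMr ?dual_denom_gt0 // mulrC.
rewrite ler_pM2l ?binratio_gt0 //.
have : 1 <= j%:R ^+ 2 :> R by rewrite -natrX ler1n expn_gt0 j0.
by lra.
Qed.

(** Allowing [k <= j] in the bound lets the odd and the even indices share one majorant, the series
    of inverse squares. *)
Lemma dual_weight_le_sqr (R : realType) (h j k : nat) : (0 < k <= j)%N ->
  (j <= h.*2)%N -> dual_weight R h j <= 2 / 63 / k%:R ^+ 2.
Proof.
move=> /andP[k0 kj] jh; have j0 : (0 < j)%N by lia.
have b1 : binratio R h.*2 j <= 1.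
  apply: le_trans (binratio_le R jh) _.
  by rewrite -[leRHS]expR0 ler_expR oppr_le0 divr_ge0.
have k1 : 1 <= k%:R ^+ 2 :> R by rewrite -natrX ler1n expn_gt0 k0.
have kj2 : k%:R ^+ 2 <= j%:R ^+ 2 :> R.
  by rewrite -!natrX ler_nat leq_exp2r.
rewrite ler_pdivrMr ?dual_denom_gt0 // mulrAC ler_pdivlMr; last by lra.
have := binratio_gt0 R jh; nra.
Qed.

Lemma sum_inv_sqr (R : realFieldType) (h : nat) :
  \sum_(k < h) (k.+1%:R ^+ 2)^-1 <= 2 :> R.
Proof.
(* The sharper bound is inductive because [1 / (x + 1) ^ 2 <= 1 / x - 1 / (x + 1)]. *)
suff {h} H h : \sum_(k < h.+1) (k.+1%:R ^+ 2)^-1 <= 2 - (h.+1%:R)^-1 :> R.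
  case: h => [|h]; first by rewrite big_ord0.
  by apply: le_trans (H h) _; rewrite gerBl invr_ge0.
elim: h => [|h IH]; first by rewrite big_ord1 expr1n invr1; lra.
rewrite big_ord_recr /=; apply: (le_trans (lerD IH (lexx _))).
have x0 : 0 < h.+1%:R :> R by rewrite ltr0n.
rewrite -(natr1 h.+1); move: x0; move: (h.+1%:R : R) => x x0.
have x1 : 0 < x + 1 by lra.
have : ((x + 1) ^+ 2)^-1 <= x^-1 - (x + 1)^-1.
  have -> : x^-1 - (x + 1)^-1 = (x * (x + 1))^-1.
    by field; rewrite !gt_eqF.
  by rewrite lef_pV2 ?posrE ?mulr_gt0 ?exprn_gt0 // expr2 ler_pM2r //; lra.
by lra.
Qed.

(** * Estimates for the weights *)

Lemma sum_dual_weight_le (R : realType) (h : nat) (f : nat -> nat) :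
  (forall k, (k < h)%N -> (k < f k <= h.*2)%N) ->
  \sum_(k < h) dual_weight R h (f k) <= 8^-1.
Proof.
move=> fP; apply: (@le_trans _ _ (\sum_(k < h) 2 / 63 * (k.+1%:R ^+ 2)^-1)).
  apply: ler_sum => k _; have /andP[kf fh] := fP k (ltn_ord k).
  exact: dual_weight_le_sqr.
by rewrite -mulr_sumr; have := sum_inv_sqr R h; lra.
Qed.

Lemma sum_dual_weight_ge0 (R : realType) (h : nat) (f : nat -> nat) :
  (forall k, (k < h)%N -> (k < f k <= h.*2)%N) ->
  0 <= \sum_(k < h) dual_weight R h (f k).
Proof.
move=> fP; apply: sumr_ge0 => k _; have /andP[kf fh] := fP k (ltn_ord k).
by rewrite ltW // dual_weight_gt0 // fh andbT (leq_trans _ kf).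
Qed.

Lemma weight_neg0_bounds (R : realType) (h : nat) :
  2^-1 <= weight_neg R h 0 <= 2.
Proof.
rewrite /weight_neg sumrB.
have fodd k : (k < h)%N -> (k < k.*2.+1 <= h.*2)%N by lia.
have feven k : (k < h)%N -> (k < k.*2.+2 <= h.*2)%N by lia.
have := sum_dual_weight_le R fodd; have := sum_dual_weight_le R feven.
have := sum_dual_weight_ge0 R fodd; have := sum_dual_weight_ge0 R feven.
by move=> /= *; apply/andP; split; lra.
Qed.

Lemma sum_weight_pos_le (R : realType) (h : nat) :
  \sum_(k < h.+1 | k != ord0) weight_pos R h k <= weight_pos R h 0 / 8.
Proof.
rewrite big_mkcond big_ord_recl /= add0r mul1r.
by apply: (@sum_dual_weight_le R h (fun k => k.*2.+1)) => k; lia.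
Qed.

(** Since [4 h <= m], the bound of [binratio_ge] costs at most a factor [m ^ (2 k)]; the
    denominator, below [256 k ^ 2 <= m ^ 2], costs no more. *)
Lemma dual_weight_ge (R : realType) (m h j k : nat) : (2560 * h <= m)%N ->
  (0 < j)%N -> (j <= k.*2)%N -> (k <= h)%N ->
  m%:R ^- (4 * k) <= dual_weight R h j.
Proof.
move=> hm j0 jk kh.
have m0 : (0 < m)%N by lia.
have m0R : 0 < m%:R :> R by rewrite ltr0n.
have jh : (j <= h.*2)%N by lia.
rewrite ler_pdivlMr ?dual_denom_gt0 //.
have bge : m%:R ^- k.*2 <= binratio R h.*2 j.
  apply: le_trans (binratio_ge R jh).
  rewrite lef_pV2 ?posrE ?exprn_gt0 ?ltr0n ?double_gt0 //; [|lia].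
  rewrite -!natrX ler_nat (@leq_trans (m ^ j)) ?leq_exp2r ?leq_pexp2l //; lia.
have Dle : 64 * j%:R ^+ 2 - 1 <= m%:R ^+ k.*2 :> R.
  apply: (@le_trans _ _ ((64 * j ^ 2)%:R)); first by rewrite natrM natrX; lra.
  rewrite -natrX ler_nat (@leq_trans (m ^ 2)) ?leq_pexp2l //; [nia|lia].
have -> : m%:R ^- (4 * k) = m%:R ^- k.*2 * m%:R ^- k.*2 :> R.
  by rewrite -invfM -exprD; congr (_ ^- _); lia.
have e0 : 0 < m%:R ^- k.*2 :> R by rewrite invr_gt0 exprn_gt0.
have : m%:R ^- k.*2 * (64 * j%:R ^+ 2 - 1) <= 1 :> R.
  by rewrite mulrC ler_pdivrMr ?exprn_gt0 // mul1r.
rewrite -mulrA => /(ler_wpM2l (ltW e0)) /le_trans; apply.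
by rewrite mulr1; lra.
Qed.

(** For [n = 2 h] the exponent in [binratio_le] is [j ^ 2 / (4 h)], and [4 h <= m / 640]. *)
Lemma dual_weight_le_exp (R : realType) (m h j : nat) : (2560 * h <= m)%N ->
  (0 < j <= h.*2)%N ->
  dual_weight R h j <= expR (- (640 * (j ^ 2)%:R / m%:R)).
Proof.
move=> hm jh; apply: le_trans (dual_weight_le_binratio R jh) _.
move: jh => /andP[j0 jh]; apply: le_trans (binratio_le R jh) _.
rewrite ler_expR lerN2.
rewrite ler_pdivrMr ?ltr0n; last by lia.
rewrite mulrAC ler_pdivlMr ?ltr0n; last by lia.
by rewrite -!natrM ler_nat; nia.
Qed.

(** Counted in exponents of [m]: the leading 4 takes at most [m], each of two factors
    [(2 (h + 1)) ^ m] at most [m], and the rest at most [3 h + 4 h]; finally [3 m + 7 h <= 5 m]. *)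
Lemma power_budget (m h : nat) : (2 <= m)%N -> (2560 * h <= m)%N ->
  (4 * (h.+1 ^ m * (h.+1 ^ m * (2 * m ^ 2) ^ h)) * 2 ^ m * (2 ^ m * m ^ (4 * h))
    <= m ^ (5 * m))%N.
Proof.
move=> m2 hm.
have -> : (4 * (h.+1 ^ m * (h.+1 ^ m * (2 * m ^ 2) ^ h)) * 2 ^ m *
    (2 ^ m * m ^ (4 * h)) =
    (2 * 2) * ((2 * h.+1) ^ m * (2 * h.+1) ^ m * ((2 * m ^ 2) ^ h * m ^ (4 * h))))%N.
  rewrite !expnMn; ring.
have m0 : (0 < m)%N by lia.
have le1 : (2 * h.+1 <= m)%N by lia.
have le2 : ((2 * h.+1) ^ m <= m ^ m)%N by rewrite leq_exp2r.
have le3 : ((2 * m ^ 2) ^ h <= m ^ (3 * h))%N.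
  case: (posnP h) => [->//|h0].
  by rewrite expnM leq_exp2r // expnS leq_mul2r m2 orbT.
have le4 : (2 * 2 <= m ^ m)%N.
  by apply: (@leq_trans (m ^ 2)); [rewrite -mulnn leq_mul | rewrite leq_pexp2l].
apply: (@leq_trans (m ^ m * (m ^ m * m ^ m * (m ^ (3 * h) * m ^ (4 * h))))).
  by rewrite !leq_mul.
by rewrite -!expnD leq_pexp2l //; lia.
Qed.

(** The 1 in the bound on [nd] accommodates the node 1. As [m <= m ^ 2 log m / 2], a heavy point has
    [64 sum j ^ 2 >= m ^ 2 log m / 2], so its exponents [640 j ^ 2 / m] add up to at least
    [5 m ln m]. It thus weighs at most [2 ^ m m ^ (- 5 m)], a simplex point at least
    [2 ^ (- m) m ^ (- 4 h)], and [power_budget] compares the two. *)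
Lemma heavy_weight_le (R : realType) (m h : nat) (a : nat -> R)
    (jj nd : nat -> nat) (u be : {ffun 'I_m -> 'I_h.+1}) :
  (2 <= m)%N -> (2560 * h <= m)%N ->
  (forall k, (k <= h)%N -> 2^-1 * m%:R ^- (4 * k) <= a k) ->
  (forall k, (k <= h)%N ->
     a k <= 2 * expR (- (640 * (jj k ^ 2)%:R / m%:R))) ->
  (forall k, nd k <= 1 + 64 * jj k ^ 2)%N ->
  (m ^ 2)%:R * log2 (m%:R : R) < \sum_i (nd (u i))%:R ->
  (\sum_i be i <= h)%N ->
  4 * ((h.+1)%:R ^+ m * ((h.+1)%:R ^+ m * (2 * (m ^ 2)%:R) ^+ h)) *
    \prod_i a (u i) <= \prod_i a (be i).
Proof.
move=> m2 hm a_ge a_le nd_le heavy beh.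
have m0 : (0 < m)%N by lia.
have m0R : 0 < m%:R :> R by rewrite ltr0n.
have kh (v : {ffun 'I_m -> 'I_h.+1}) i : (v i <= h)%N by rewrite -ltnS.
have a0 k : (k <= h)%N -> 0 <= a k.
  by move=> /a_ge /(le_trans _); apply; rewrite mulr_ge0 ?invr_ge0 ?exprn_ge0.
have upper : \prod_i a (u i) <= 2 ^+ m * m%:R ^- (5 * m).
  apply: (@le_trans _ _ (\prod_i (2 * expR (- (640 * (jj (u i) ^ 2)%:R / m%:R))))).
    by apply: ler_prod => i _; rewrite a0 //= a_le.
  rewrite big_split /= prodr_const card_ord ler_pM2l ?exprn_gt0 //.
  have -> : m%:R ^- (5 * m) = expR (- ((5 * m)%:R * ln (m%:R : R))).
    by rewrite expRN expRM_natl lnK ?posrE.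
  rewrite -expR_sum ler_expR sumrN lerN2 -!mulr_suml -mulr_sumr.
  rewrite ler_pdivlMr //.
  have ln2_gt0 : 0 < ln (2 : R) by rewrite ln_gt0 // ltr1n.
  have ln2_le1 : ln (2 : R) <= 1.
    have := @le_ln1Dx R 1 (lt_trans (ltrN10 R) ltr01).
    by rewrite -[1 + 1]/(2%:R).
  have lnm : ln (2 : R) <= ln (m%:R : R) by rewrite ler_ln ?posrE // ler_nat.
  have log_ge : ln (m%:R : R) <= log2 (m%:R : R).
    by rewrite /log2 ler_pdivlMr // ler_piMr // (le_trans (ltW ln2_gt0)).
  have log_ge1 : 1 <= log2 (m%:R : R) by rewrite /log2 ler_pdivlMr // mul1r.
  have nd_sum : \sum_i (nd (u i))%:R <=
      m%:R + 64 * \sum_i (jj (u i) ^ 2)%:R :> R.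
    rewrite -!natr_sum -natrM -natrD ler_nat.
    apply: (@leq_trans (\sum_(i < m) (1 + 64 * jj (u i) ^ 2))).
      by apply: leq_sum.
    by rewrite big_split /= sum1_card card_ord big_distrr.
  have mm : m%:R * 2 <= m%:R ^+ 2 :> R by rewrite expr2 ler_pM2l // ler_nat.
  have w_ge : m%:R ^+ 2 <= m%:R ^+ 2 * log2 (m%:R : R).
    by rewrite ler_peMr // exprn_ge0.
  have : m%:R ^+ 2 * ln (m%:R : R) <= m%:R ^+ 2 * log2 (m%:R : R).
    by rewrite ler_pM2l // exprn_gt0.
  move: heavy nd_sum; rewrite natrX natrM.
  by move: (\sum_i (jj (u i) ^ 2)%:R) (\sum_i (nd (u i))%:R) => S T; lra.
have lower : 2 ^- m * m%:R ^- (4 * h) <= \prod_i a (be i).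
  apply: (@le_trans _ _ (\prod_i (2^-1 * m%:R ^- (4 * be i)))); last first.
    apply: ler_prod => i _; rewrite a_ge // andbT mulr_ge0 ?invr_ge0 //.
    by rewrite exprn_ge0.
  rewrite big_split /= prodr_const card_ord exprVn ler_pM2l ?invr_gt0 ?exprn_gt0 //.
  rewrite -[X in _ <= X]invrK lef_pV2 ?posrE ?exprn_gt0 //; last first.
    by rewrite invr_gt0 prodr_gt0 // => i _; rewrite invr_gt0 exprn_gt0.
  rewrite -prodfV; under eq_bigr => i _ do rewrite invrK.
  rewrite -expr_sum -big_distrr /= ler_weXn2l ?ler1n //.
  by rewrite leq_mul2l beh orbT.
apply: le_trans lower.
have C0 : 0 <= 4 * (h.+1%:R ^+ m * (h.+1%:R ^+ m * (2 * (m ^ 2)%:R) ^+ h)) :> R.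
  by rewrite !mulr_ge0 ?exprn_ge0 ?mulr_ge0.
apply: le_trans (ler_wpM2l C0 upper) _.
rewrite -invfM [leLHS]mulrA ler_pdivrMr ?exprn_gt0 // [leRHS]mulrC.
rewrite ler_pdivlMr ?mulr_gt0 ?exprn_gt0 //.
by rewrite -!(natrX, natrM) ler_nat power_budget.
Qed.

(** * The lower bound *)

(** This excludes the dummy value of [threshold_degree]. On the domain, the product for axis [i]
    vanishes when [t i >= 1] and is the factorial of [m ^ 2] when [t i = 0]; subtracting 1/2 from
    the sum of the products gives the right sign. *)
Lemma sign_degree_MPstar_ex (R : realType) (m : nat) (w : R) :
  exists d, `[< sign_degree (MPstar_dom_le m w) (@MPstar R m) d >].
Proof.
pose p : mpoly m R := \sum_(i < m) \prod_(k < m ^ 2)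
  (mpolyC m (k.+1%:R : R) - mpolyX R (mnm1 i)) - mpolyC m (2^-1 : R).
exists (mpoly_degree p); apply/asboolP; exists p => // t [tdom _].
pose T i := \prod_(k < m ^ 2) (k.+1%:R - t i).
have pE : meval t p = \sum_i T i - 2^-1.
  rewrite /p mevalB mevalC rmorph_sum; congr (_ - _); apply: eq_bigr => i _.
  rewrite rmorph_prod; apply: eq_bigr => k _ /=.
  by rewrite mevalB mevalC mevalXU.
have T0 i : 1 <= t i -> T i = 0.
  have [k km tE] := tdom i; rewrite /T tE.
  case: k km {tE} => [|k] km; first by rewrite ler10.
  by move=> _; rewrite (bigD1 (Ordinal km)) //= subrr mul0r.
have T1 i : ~~ (1 <= t i) -> 1 <= T i.
  have [k km tE] := tdom i; rewrite /T tE ler1n -eqn0Ngt => /eqP ->.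
  under eq_bigr => j _ do rewrite subr0.
  by rewrite -natr_prod ler1n prodn_gt0.
rewrite pE; case: (boolP (MPstar t)) => [/forallP t1|/forallPn[i ti]].
  rewrite big1 => [|i _]; last exact: T0.
  by rewrite sub0r sgrN gtr0_sg ?invr_gt0.
rewrite gtr0_sg // subr_gt0 (bigD1 i) //=.
have := T1 i ti.
have : 0 <= \sum_(j < m | j != i) T j; last by lra.
apply: sumr_ge0 => j _; case: (boolP (1 <= t j)) => [/T0 -> //|/T1].
by apply: le_trans.
Qed.

Lemma natr_dist_ge1 (R : realDomainType) (a b : nat) :
  a != b -> 1 <= `|a%:R - b%:R| :> R.
Proof.
wlog lt_ab : a b / (a < b)%N => [H ab|_].
  by have [/H->//|/H|/eqP] := ltngtP a b; rewrite ?(negbTE ab) // distrC;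
     apply; rewrite eq_sym.
by rewrite distrC -natrB ?(ltnW lt_ab) // normr_nat ler1n subn_gt0.
Qed.

Lemma natr_dist_le (R : realDomainType) (a b M : nat) :
  (a <= M)%N -> (b <= M)%N -> `|a%:R - b%:R| <= M%:R :> R.
Proof.
rewrite -!(ler_nat R) ler_norml => aM bM.
by have := ler0n R a; have := ler0n R b; move=> *; apply/andP; split; lra.
Qed.

Lemma node_pos_inj j k : j != k -> node_pos j != node_pos k.
Proof. by rewrite /node_pos; nia. Qed.

Lemma node_neg_inj j k : j != k -> node_neg j != node_neg k.
Proof. by case: j k => [|j] [|k]; rewrite /node_neg; nia. Qed.

Lemma node_pos_le m h k : (2560 * h <= m)%N -> (k <= h)%N ->
  (node_pos k <= m ^ 2)%N.
Proof. by rewrite /node_pos; nia. Qed.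

Lemma node_neg_le m h k : (2 <= m)%N -> (2560 * h <= m)%N -> (k <= h)%N ->
  (node_neg k <= m ^ 2)%N.
Proof. by case: k => [|k]; rewrite /node_neg; nia. Qed.

Lemma sqr_le_weight_bound (R : realType) (m : nat) : (2 <= m)%N ->
  (m ^ 2)%:R <= (m ^ 2)%:R * log2 (m%:R : R).
Proof.
move=> m2; rewrite ler_peMr // /log2 ler_pdivlMr ?ln_gt0 ?ltr1n // mul1r.
by rewrite ler_ln ?posrE ?ltr0n ?ler_nat //; lia.
Qed.

Lemma low_degree_not_sign_representing (R : realType) (m h : nat)
    (p : mpoly m R) :
  (2 <= m)%N -> (2560 * h <= m)%N -> (msize p <= h.+1)%N ->
  ~ sign_represents (MPstar_dom_le m ((m ^ 2)%:R * log2 (m%:R : R)))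
      (@MPstar R m) p.
Proof.
move=> m2 hm ph rep; set w := _ * log2 _ in rep.
have mw : (m ^ 2)%:R <= w := sqr_le_weight_bound R m2.
have m1 : 1 <= (m ^ 2)%:R :> R by rewrite ler1n expn_gt0; lia.
have repP (nd : nat -> nat) (u : {ffun 'I_m -> 'I_h.+1}) :
    (forall k, (k <= h)%N -> (nd k <= m ^ 2)%N) ->
    \sum_i (nd (u i))%:R <= w ->
    Num.sg (meval (fun i => (nd (u i))%:R) p) =
      (-1) ^+ [forall i, (0 < nd (u i))%N].
  move=> ndm light; rewrite rep; last first.
    by split=> // i; exists (nd (u i)); rewrite ?ndm // -ltnS.
  by rewrite /MPstar; under eq_forallb => i do rewrite ler1n.
(* Nodes are at most [1 + 256 k ^ 2 <= 1 + 256 h k], so rank at most [h] gives weight at most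
   [m + 256 h ^ 2 <= m ^ 2 <= w]. *)
have simplex (nd : nat -> nat) (be : {ffun 'I_m -> 'I_h.+1}) :
    (forall k, (k <= h)%N -> (nd k <= 1 + 256 * h * k)%N) ->
    (\sum_i be i <= h)%N -> \sum_i (nd (be i))%:R <= w.
  move=> ndh beh; apply: le_trans mw; rewrite -natr_sum ler_nat.
  apply: (@leq_trans (\sum_(i < m) (1 + 256 * h * be i))).
    by apply: leq_sum => i _; apply: ndh; rewrite -ltnS.
  rewrite big_split /= sum1_card card_ord -big_distrr /=.
  apply: (@leq_trans (m + 256 * h * h)); last by nia.
  by rewrite leq_add2l leq_mul2l beh orbT.
apply: (@no_low_degree_sign R m h (fun k => (node_pos k)%:R)
  (fun k => (node_neg k)%:R) (m ^ 2)%:R (fun k => weight_pos R h k)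
  (fun k => weight_neg R h k) p
  (fun u => \sum_i (node_pos (u i))%:R <= w)
  (fun u => \sum_i (node_neg (u i))%:R <= w)) => //.
- lia.
- by case=> [[|k] kh] //=; apply: dual_weight_gt0; lia.
- case=> [[|k] kh] /=; last by apply: dual_weight_gt0; lia.
  have /andP[ge _] := weight_neg0_bounds R h.
  by apply: lt_le_trans ge; rewrite invr_gt0.
- exact: moments_match.
- exact: sum_weight_pos_le.
- by move=> j k jh kh; apply: natr_dist_le; apply: node_pos_le hm _.
- by move=> j k /node_pos_inj; exact: natr_dist_ge1.
- by move=> j k jh kh; apply: natr_dist_le; apply: node_neg_le m2 hm _.
- by move=> j k /node_neg_inj; exact: natr_dist_ge1.
- move=> u be; apply: le_trans; apply: ler_sum => i _; rewrite ler_nat ffunE.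
  by case: ifP.
- by move=> be; apply: simplex => k; rewrite /node_pos; nia.
- by move=> be; apply: simplex => -[|k]; rewrite /node_neg; nia.
- move=> u be; rewrite -ltNge => heavy beh.
  apply: (@heavy_weight_le R m h (weight_pos R h) (fun k => k.*2.-1) node_pos)
    => //.
  + case=> [|k] kh; first by rewrite muln0 expr0 invr1 /=; lra.
    have : m%:R ^- (4 * k.+1) <= weight_pos R h k.+1.
      by apply: dual_weight_ge => //; lia.
    have : 0 <= m%:R ^- (4 * k.+1) :> R by rewrite invr_ge0 exprn_ge0.
    by lra.
  + case=> [|k] kh; first by rewrite /= mulr0 mul0r oppr0 expR0; lra.
    have : weight_pos R h k.+1 <=
        expR (- (640 * (k.+1.*2.-1 ^ 2)%:R / m%:R)).
      by apply: dual_weight_le_exp => //; lia.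
    by have := expR_gt0 (- (640 * (k.+1.*2.-1 ^ 2)%:R / m%:R) : R); lra.
- move=> u be; rewrite -ltNge => heavy beh.
  apply: (@heavy_weight_le R m h (weight_neg R h) double node_neg) => //.
  + case=> [|k] kh.
      rewrite muln0 expr0 invr1 mulr1.
      by have /andP[] := weight_neg0_bounds R h.
    have : m%:R ^- (4 * k.+1) <= weight_neg R h k.+1.
      by apply: dual_weight_ge => //; lia.
    have : 0 <= m%:R ^- (4 * k.+1) :> R by rewrite invr_ge0 exprn_ge0.
    by lra.
  + case=> [|k] kh.
      rewrite double0 mulr0 mul0r oppr0 expR0 mulr1.
      by have /andP[] := weight_neg0_bounds R h.
    have : weight_neg R h k.+1 <= expR (- (640 * (k.+1.*2 ^ 2)%:R / m%:R)).
      by apply: dual_weight_le_exp => //; lia.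
    by have := expR_gt0 (- (640 * (k.+1.*2 ^ 2)%:R / m%:R) : R); lra.
  + by case.
- move=> u light [i /eqP ui].
  rewrite -sgr_gt0 (repP node_pos) //; last by move=> k; exact: node_pos_le.
  have -> : [forall i, (0 < node_pos (u i))%N] = false.
    by apply/forallP => /(_ i); rewrite ui.
  by rewrite expr0.
- move=> u light u0.
  rewrite -sgr_lt0 (repP node_pos) //; last by move=> k; exact: node_pos_le.
  have -> : [forall i, (0 < node_pos (u i))%N].
    apply/forallP => i; have := u0 i; rewrite -val_eqE /= -lt0n /node_pos.
    by nia.
  by rewrite expr1 ltrN10.
(* The second grid avoids the value 0, so [MPstar] holds on all its light points. *)
- move=> u light.
  rewrite -sgr_lt0 (repP node_neg) //; last by move=> k; exact: node_neg_le.
  have -> : [forall i, (0 < node_neg (u i))%N].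
    by apply/forallP => i; case: (nat_of_ord (u i)).
  by rewrite expr1 ltrN10.
Qed.

Theorem theorem4p11 (R : realType) :
  exists c : R, 0 < c /\
    forall m : nat, (2 <= m)%N ->
      c * m%:R <= (degpm_MPstar_le m ((m ^ 2)%:R * log2 (m%:R : R)))%:R.
Proof.
exists 2560^-1; split=> [|m m2]; first by rewrite invr_gt0.
rewrite /degpm_MPstar_le /threshold_degree.
case: pselect => [ex_d|/(_ (sign_degree_MPstar_ex m _))//].
case: ex_minnP => d /asboolP[p rep pd] _.
set h := (m %/ 2560)%N.
have hm : (2560 * h <= m)%N by rewrite mulnC leq_trunc_div.
have hd : (h < d)%N.
  rewrite ltnNge; apply/negP => dh.
  apply: (low_degree_not_sign_representing m2 hm _ rep).
  by move: pd; rewrite /mpoly_degree; move: (mmeasure _ p) => s; lia.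
(* The strict inequality [h < d] makes up for the rounding in [h]. *)
rewrite mulrC ler_pdivrMr // -natrM ler_nat.
have := ltn_ceil m (isT : (0 < 2560)%N); rewrite -/h; lia.
Qed.
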